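(* Let $k\ge2$, let $M$ be a path-connected topological space with an involution $\tau\colon M\to M$, and let $\sigma\colon S^1\to S^1$ be the antipodal involution $\sigma(z)=-z$. If $X(M,S^1)$ is Hausdorff and $X(M,S^1)^k$ is completely normal, then $$\mathrm{TC}_k(X(M,S^1))\le k+\mathrm{TC}_{k,\langle\tau\rangle}^{\#,*}(M)\le k\,\mathrm{cat}_{\langle\tau\rangle}^{\#}(M)+1 .$$
   Context: For spaces $M,N$ with involutions $\tau$ on $M$ and $\sigma$ on $N$, $\sigma$ fixed-point free, the generalized projective product space is $X(M,N)=(M\times N)/\bigl((x,y)\sim(\tau(x),\sigma(y))\bigr)$. $\langle\tau\rangle$ is the group generated by $\tau$. $X^I$ is the space of paths $[0,1]\to X$ with the compact-open topology, and $e_{k,X}\colon X^I\to X^k$ is $e_{k,X}(\alpha)=\left(\alpha(0),\alpha(\tfrac1{k-1}),\dots,\alpha(\tfrac{k-2}{k-1}),\alpha(1)\right)$. $\mathrm{TC}_k(X)$ is the smallest $n$ such that $X^k$ has an open cover by $n$ sets over each of which $e_{k,X}$ has a continuous section. For a $G$-space $X$, $\mathrm{TC}_{k,G}^{\#,*}(X)$ is the smallest $n$ such that $X^k$ has an open cover by $n$ sets invariant under the componentwise $G^k$-action, over each of which $e_{k,X}$ has a continuous (not necessarily equivariant) section; $\mathrm{cat}_G^{\#}(X)$ is the smallest $n$ such that $X$ has an open cover by $n$ $G$-invariant sets each of whose inclusions into $X$ is null-homotopic (non-equivariantly). Each invariant is $\infty$ if no such $n$ exists. *)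

(* Defs.v *)
From HB Require Import structures.
From Stdlib Require Import Relations.
From mathcomp Require Import all_boot all_order all_algebra generic_quotient.
From mathcomp Require Import all_classical all_reals all_analysis.
Set Implicit Arguments.
Unset Strict Implicit.
Unset Printing Implicit Defensive.
Import Order.TTheory GRing.Theory Num.Theory.
Import numFieldNormedType.Exports.
Local Open Scope classical_set_scope.
Local Open Scope ring_scope.

(* Separated sets have disjoint neighbourhoods; no T1 axiom is included. *)
Definition completely_normal_space (T : topologicalType) : Prop :=
  forall A B : set T, separated A B ->
    exists U V : set T,
      [/\ open U, open V, A `<=` U, B `<=` V & U `&` V = set0].

Section paths.
Variable R : realType.

Definition unit_interval : Type := set_type (`[0, 1]%classic : set R).
HB.instance Definition _ := Topological.on unit_interval.

Lemma unit_node_subproof (k : nat) (i : 'I_k) :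
  (i%:R / k.-1%:R : R) \in (`[0, 1]%classic : set R).
Proof.
apply/mem_set; rewrite /= in_itv /=; apply/andP; split.
  by rewrite divr_ge0.
have lei : (i <= k.-1)%N by case: k i => [[]//|k] i; exact: leq_ord.
have [k0|k1] := posnP k.-1; first by rewrite k0 invr0 mulr0.
by rewrite ler_pdivrMr ?ltr0n// mul1r ler_nat.
Qed.

(* For k = 1 the only node is 0 / 0 = 0. *)
Definition unit_node (k : nat) (i : 'I_k) : unit_interval :=
  exist _ (i%:R / k.-1%:R) (unit_node_subproof i).

Definition unit0 : unit_interval := @unit_node 2 ord0.
Definition unit1 : unit_interval := @unit_node 2 ord_max.

Lemma val_unit0 : val unit0 = 0.
Proof. by rewrite /= mul0r. Qed.

Lemma val_unit1 : val unit1 = 1.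
Proof. by rewrite /= divr1. Qed.

Definition path_space (X : topologicalType) : Type :=
  continuousType unit_interval X.
HB.instance Definition _ (X : topologicalType) := Choice.on (path_space X).
HB.instance Definition _ (X : topologicalType) :=
  Topological.copy (path_space X)
    (@initial_topology (path_space X) {compact-open, unit_interval -> X}
       (fun f => f)).

Definition path_eval (k : nat) (X : topologicalType) (f : path_space X) :
  {ptws 'I_k -> X} := fun i => f (unit_node i).
Arguments path_eval k {X} f.

Definition path_connected_space (X : topologicalType) : Prop :=
  [set: X] !=set0 /\
  forall x y : X, exists f : path_space X, f unit0 = x /\ f unit1 = y.

Definition path_section (k : nat) (X : topologicalType)
    (U : set {ptws 'I_k -> X}) : Prop :=
  exists s : {ptws 'I_k -> X} -> path_space X,
    {within U, continuous s} /\ forall x, U x -> path_eval k (s x) = x.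

Definition null_homotopic_inclusion (X : topologicalType) (U : set X) : Prop :=
  exists (H : X * unit_interval -> X) (c : X),
    [/\ {within U `*` setT, continuous H},
        forall x, U x -> H (x, unit0) = x &
        forall x, U x -> H (x, unit1) = c].

(* The least size of an open cover by sets satisfying P, or +oo if there is
   none: a nonempty set of natural numbers attains its infimum. *)
Definition cover_number (T : topologicalType) (P : set T -> Prop) : \bar R :=
  ereal_inf [set n%:R%:E | n in [set n : nat |
    exists U : 'I_n -> set T,
      (forall i, open (U i) /\ P (U i)) /\ \bigcup_i U i = setT]].

End paths.

(* A G-space X is represented by the set of self-homeomorphisms of X through
   which G acts; invariance of a subset only depends on this set. *)
Section transformation_groups.
Variable X : topologicalType.

Definition transformation_group (G : set (X -> X)) : Prop :=
  [/\ forall g, G g -> continuous g,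
      G id,
      forall g h, G g -> G h -> G (g \o h) &
      forall g, G g -> exists h, [/\ G h, cancel g h & cancel h g]].

Definition generated_group (tau : X -> X) : set (X -> X) :=
  smallest transformation_group [set tau].

Definition invariant_set (G : set (X -> X)) (U : set X) : Prop :=
  forall g, G g -> forall x, U x -> U (g x).

End transformation_groups.

Definition power_group (k : nat) (X : topologicalType) (G : set (X -> X)) :
    set ({ptws 'I_k -> X} -> {ptws 'I_k -> X}) :=
  [set a | exists g : 'I_k -> X -> X,
     (forall i, G (g i)) /\ a = (fun x i => g i (x i))].
Arguments power_group k {X} G _.

Definition TC (R : realType) (k : nat) (X : topologicalType) : \bar R :=
  cover_number R (@path_section R k X).

(* TC_{k,G}^{#,*}(X): the cover is invariant, the sections are not required to
   be equivariant. *)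
Definition TC_sharp_star (R : realType) (k : nat) (X : topologicalType)
    (G : set (X -> X)) : \bar R :=
  cover_number R (fun U : set {ptws 'I_k -> X} =>
    invariant_set (power_group k G) U /\ path_section R U).

(* cat_G^#(X): likewise, the homotopies are not required to be equivariant. *)
Definition cat_sharp (R : realType) (X : topologicalType)
    (G : set (X -> X)) : \bar R :=
  cover_number R (fun U : set X =>
    invariant_set G U /\ null_homotopic_inclusion R U).

Section projective_product.
Variables (M N : topologicalType) (tau : M -> M) (sigma : N -> N).

Definition proj_prod_rel : rel (M * N) := fun p q =>
  `[< clos_refl_sym_trans (M * N)
        (fun p q => q = (tau p.1, sigma p.2)) p q >].

Lemma proj_prod_rel_refl : reflexive proj_prod_rel.
Proof. by move=> p; apply/asboolP; exact: rst_refl. Qed.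

Lemma proj_prod_rel_sym : symmetric proj_prod_rel.
Proof.
by move=> p q; apply/asboolP/asboolP => h; exact: rst_sym.
Qed.

Lemma proj_prod_rel_trans : transitive proj_prod_rel.
Proof.
move=> q p r /asboolP pq /asboolP qr; apply/asboolP.
exact: rst_trans pq qr.
Qed.

Definition proj_prod_equiv : equiv_rel (M * N) :=
  EquivRel proj_prod_rel proj_prod_rel_refl proj_prod_rel_sym
    proj_prod_rel_trans.

Definition proj_prod : topologicalType :=
  quotient_topology {eq_quot proj_prod_equiv}%qT.

End projective_product.

Section circle.
Variable R : realType.

Definition circle : set (R * R) := [set z | z.1 ^+ 2 + z.2 ^+ 2 = 1].

Lemma antipode_subproof (z : set_type circle) : - val z \in circle.
Proof.
case: z => -[a b] /= /set_mem h; apply/mem_set.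
by rewrite /circle /= !sqrrN.
Qed.

Definition antipode (z : set_type circle) : set_type circle :=
  exist _ (- val z) (antipode_subproof z).

End circle.

(* Main.v *)
Require Import Defs.
From mathcomp Require Import all_boot all_order all_algebra.
From mathcomp Require Import all_classical all_reals all_analysis.
From mathcomp Require Import lra zify.
Import Order.TTheory GRing.Theory Num.Theory.
Import numFieldNormedType.Exports.
Local Open Scope classical_set_scope.
Local Open Scope ring_scope.
Set Implicit Arguments.
Unset Strict Implicit.
Unset Printing Implicit Defensive.

(** Write X for the quotient of M * S^1 by (x, z) ~ (tau x, -z).

    Both inequalities come from one counting device.  Give every point of a
    completely normal space T a colour in a finite set, such that the colours
    carry numerical coordinates h_j that are upper semicontinuous, in the
    sense that each set {h_j <= v} is open, and a rank r such that two distinct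
    colours of equal rank are never comparable coordinate by coordinate.  If
    h_j(a) < h_j(b), the open set {h_j <= h_j(a)} contains the points coloured
    a and misses those coloured b, so that, of two colours of equal rank, each
    colour class misses the closure of the other.  Complete normality then
    thickens the colour classes to open sets, disjoint within each rank
    ([ranked_open_family]), and continuous sections over disjoint open sets
    glue ([path_section_disjoint]).  The number of open sets that are needed is
    the number of ranks, not the number of colours.

    First inequality.  The circle S^1 / {1, -1} is covered by the two images of
    the open half circles z.1 > 0 and z.2 > 0; over either of them, choosing
    the representative that lies in the half circle splits X as M times the
    half circle ([lift_arc_continuous]).  A cover of M^k by n invariant sets
    with sections pulls back to an open cover of X^k.  A point of X^k is
    coloured by one bit for each coordinate (which half circle to use) and by
    the index of the first set of that cover containing it; the rank, the sum
    of the k bits and of the index, takes k + n values.  On one colour the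
    coordinates lift continuously to M^k and to (S^1)^k.  The path in M is the
    one given by the section over M^k; the path in S^1 is the radial projection
    of a planar path which goes from one prescribed point to the next through
    the vertex (1, 1).  The segment from a point of either half plane to (1, 1)
    stays in that half plane, so the planar path avoids the origin
    ([path_section_arcs], [TC_cover]).

    Second inequality.  M embeds in X as the fibre over (1, 0), and the local
    lift retracts a neighbourhood of it onto M; hence M^k is completely normal
    as well ([completely_normal_fiber]).  Given a cover of M by n invariant
    sets that are null-homotopic in M, colour a point of M^k by the k indices
    of the first set containing each coordinate; the sum of these indices takes
    k (n - 1) + 1 values.  On one colour, every coordinate has a homotopy to
    one and the same base point, because M is path-connected, and a path
    through all coordinates returns to the base point between any two nodes
    ([path_section_box]).  The open sets are made invariant by intersecting
    their finitely many translates ([flip_coreP], [TC_sharp_star_cover]). *)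

(** * Pointwise continuity, pasting, and the exponential law for paths *)

Lemma ptws_proj_continuous (I : eqType) (X : topologicalType) (i : I) :
  continuous (fun q : {ptws I -> X} => q i).
Proof. exact: (@proj_continuous I (fun=> X) i). Qed.

Section pointwise_continuity.
Variable T : topologicalType.
Implicit Types (x : T).

Lemma continuous_at_cst (U : topologicalType) (u : U) x :
  {for x, continuous (fun=> u)}.
Proof. exact: cst_continuous. Qed.

Lemma continuous_at_id x : {for x, continuous id}.
Proof. by []. Qed.

Lemma continuous_at_pair (U V : topologicalType) (f : T -> U) (g : T -> V) x :
  {for x, continuous f} -> {for x, continuous g} ->
  {for x, continuous (fun y => (f y, g y))}.
Proof. exact: cvg_pair. Qed.

Lemma continuous_at_fst (U V : topologicalType) (f : T -> U * V) x :
  {for x, continuous f} -> {for x, continuous (fun y => (f y).1)}.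
Proof. by move=> fc; exact: (continuous_comp fc (@cvg_fst _ _ _ _ _)). Qed.

Lemma continuous_at_snd (U V : topologicalType) (f : T -> U * V) x :
  {for x, continuous f} -> {for x, continuous (fun y => (f y).2)}.
Proof. by move=> fc; exact: (continuous_comp fc (@cvg_snd _ _ _ _ _)). Qed.

Lemma near_eq_continuous_at (U : topologicalType) (f g : T -> U) x :
  (\forall y \near x, f y = g y) ->
  {for x, continuous f} -> {for x, continuous g}.
Proof.
move=> fg fc; have fgx : f x = g x := nbhs_singleton fg.
move=> B; rewrite -fgx => /fc /=; apply: filterS2 fg => y /= <-.
by [].
Qed.

Lemma continuous_at_ptws (I : eqType) (X : topologicalType)
    (f : T -> {ptws I -> X}) x :
  (forall i, {for x, continuous (fun y => f y i)}) -> {for x, continuous f}.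
Proof.
move=> fc; apply/cvg_sup => i B [/= _ [[W oW <-] /= Wfx WB]].
apply: (filterS WB) => {B WB}.
exact: (fc i W (open_nbhs_nbhs (conj oW Wfx))).
Qed.

(** The pasting lemma for finitely many closed sets, in a pointwise form: only
    the pieces through x have to be continuous at x, so it applies to functions
    that are continuous on an open subset only. *)
Lemma finite_pasting (U : topologicalType) (I : finType) (C : I -> set T)
    (f : I -> T -> U) (g : T -> U) x :
  (forall i, closed (C i)) ->
  (forall y, exists2 i, C i y & g y = f i y) ->
  (forall i, C i x -> {for x, continuous (f i)} /\ f i x = g x) ->
  {for x, continuous g}.
Proof.
move=> Cc gE fc B gB.
have near_i : \forall y \near x, forall i, C i y -> B (f i y).
  apply: filter_forall => i; have [Cx|nCx] := pselect (C i x).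
    have [fci fx] := fc i Cx; rewrite -fx in gB.
    have : \forall y \near x, B (f i y) := fci _ gB.
    by apply: filterS => y.
  have : nbhs x (~` C i) by apply: open_nbhs_nbhs; split=> //; exact/closed_openC.
  by apply: filterS => y.
by apply: filterS near_i => y Cy /=; have [i Ci ->] := gE y; exact: Cy.
Qed.

End pointwise_continuity.

(** The tube lemma: for a compact set K of times and an open set W, the
    neighbourhoods of the points (x, t), t in K, on which the path stays in W
    can be taken uniform in t.  Continuity is asked along {x} * [0,1] only,
    so that no continuity of s away from x is assumed. *)
Lemma path_space_curry (R : realType) (T X : topologicalType)
    (s : T -> path_space R X) (x : T) :
  (forall t, {for (x, t), continuous (fun p => s p.1 p.2)}) ->
  {for x, continuous s}.
Proof.
move=> sc B [/= _ [[W oW <-] /= Wsx WB]].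
apply: (filterS WB) => {B WB}.
have : (fun y => s y : {compact-open, unit_interval R -> X}) @ x --> 
     (s x : {compact-open, unit_interval R -> X}).
  apply/compact_open_cvgP => K O /= cK oO sKO.
  near=> z => w /= [+ + <-]; near: z.
  move/compact_near_coveringP/near_covering_withinP : cK; apply.
  move=> t Kt; have [[P Q] [Px Qt] PQO] := sc t O 
      (open_nbhs_nbhs (conj oO (sKO _ (ex_intro2 _ _ t Kt erefl)))).
  by exists (Q, P) => // -[b a] /= [Qb Pa] Kb; exact: (PQO (a, b)).
by apply; exact: open_nbhs_nbhs.
Unshelve. all: by end_near. Qed.

Lemma clamp_subproof (R : realType) (t : R) :
  Num.min 1 (Num.max 0 t) \in (`[0, 1]%classic : set R).
Proof.
by apply/mem_set; rewrite /= in_itv /= le_min ler01 le_max lexx ge_min lexx.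
Qed.

(** The retraction of the line onto [0,1].  It transports neighbourhoods and
    compact sets from the line to the interval, and lets homotopies be
    parametrized by all real numbers. *)
Definition clamp (R : realType) (t : R) : unit_interval R :=
  exist _ (Num.min 1 (Num.max 0 t)) (clamp_subproof t).

Lemma val_unit_continuous (R : realType) :
  continuous (val : unit_interval R -> R).
Proof. exact: initial_continuous. Qed.

Lemma clamp_continuous (R : realType) : continuous (@clamp R).
Proof.
apply: continuous_comp_initial => t.
have -> : set_val \o @clamp R = (fun t => Num.min 1 (Num.max 0 t)) by [].
apply: continuous_min; first exact: cvg_cst.
by apply: continuous_max; [exact: cvg_cst|exact: cvg_id].
Qed.

Lemma val_unit_itv (R : realType) (t : unit_interval R) : 0 <= val t <= 1.
Proof. by have := set_valP t; rewrite /= in_itv. Qed.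

Lemma clampK (R : realType) : cancel val (@clamp R).
Proof.
move=> t; apply: val_inj => /=; have /andP[t0 t1] := val_unit_itv t.
by rewrite max_r// min_r.
Qed.

(** Evaluation is continuous because [0,1] is locally compact: the image under
    [clamp] of a small closed ball is a compact neighbourhood of t. *)
Lemma path_space_uncurry (R : realType) (T X : topologicalType)
    (s : T -> path_space R X) (x : T) (t : unit_interval R) :
  {for x, continuous s} -> {for (x, t), continuous (fun p => s p.1 p.2)}.
Proof.
move=> sc B /=; rewrite nbhsE => -[W [oW Wsxt] WB].
apply: (filterS WB) => {B WB}.
have : nbhs (val t) (@clamp R @^-1` (s x @^-1` W)).
  apply: clamp_continuous; rewrite clampK.
  by apply: (@cts_fun _ _ (s x)); exact: open_nbhs_nbhs.
move=> /nbhs_closedballP[e eW].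
(* A compact neighbourhood of t that s x maps into W. *)
pose K := @clamp R @` closed_ball (val t) e%:num.
have Kt : nbhs t K.
  have : nbhs t (val @^-1` closed_ball (val t) e%:num).
    apply: val_unit_continuous; apply: (@filterS _ _ _ (ball (val t) e%:num)).
      exact: subset_closed_ball.
    exact: nbhsx_ballx.
  by apply: filterS => t' /= tt'; exists (val t'); rewrite ?clampK.
have cK : compact K.
  apply: continuous_compact.
    exact/continuous_subspaceT/clamp_continuous.
  exact: closed_ballR_compact.
exists (s @^-1` [set f | f @` K `<=` W], K).
  split=> //=; apply: sc; apply: open_nbhs_nbhs; split.
    exists [set f : {compact-open, unit_interval R -> X} | f @` K `<=` W] => //.
    exact: compact_open_open.
  by move=> _ [_ [u /eW uW <-] <-].
by case=> y u /= [sW Ku]; apply: sW; exists u.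
Qed.

(** Sections are built below as motions F x t, continuous in the pair.  Outside
    of U, where F x need not be a path, a constant path is used. *)
Lemma joint_path_section (R : realType) (k : nat) (X : topologicalType)
    (U : set {ptws 'I_k -> X}) (F : {ptws 'I_k -> X} -> unit_interval R -> X) :
  open U ->
  (forall x t, U x -> {for (x, t), continuous (fun p => F p.1 p.2)}) ->
  (forall x i, U x -> F x (@unit_node R k i) = x i) ->
  path_section R U.
Proof.
move=> oU Fc Fx.
have Fcx x : U x -> continuous (F x).
  move=> Ux t; apply: (@continuous_comp _ _ _ (fun t => (x, t))
    (fun p => F p.1 p.2)); last exact: Fc.
  by apply: continuous_at_pair; [exact: continuous_at_cst|exact: continuous_at_id].
have mk (x : {ptws 'I_k -> X}) : {f : path_space R X | U x -> forall t, f t = F x t}.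
  have [Ux|nUx] := pselect (U x).
    by exists (mkcts (Fcx x Ux)).
  have cc : continuous (fun _ : unit_interval R => F x (unit0 R)).
    exact: cst_continuous.
  by exists (mkcts cc).
exists (fun x => sval (mk x)); split; last first.
  move=> x Ux; apply/funext => i; rewrite /path_eval.
  by rewrite (svalP (mk x) Ux) Fx.
rewrite continuous_open_subspace// => x /set_mem Ux.
apply: path_space_curry => t.
apply: near_eq_continuous_at (Fc x t Ux).
exists (U, setT) => /=; first by split; [exact: open_nbhs_nbhs|exact: filterT].
by case=> y u /= [Uy _]; rewrite (svalP (mk y) Uy).
Qed.

(** * Separating colour classes in completely normal spaces *)

Lemma open_forall (T : topologicalType) (I : finType) (A : I -> set T) :
  (forall i, open (A i)) -> open [set x | forall i, A i x].
Proof.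
move=> oA; rewrite openE => x Ax; apply: filter_forall => i.
exact: open_nbhs_nbhs.
Qed.

Lemma open_disjoint_closure (T : topologicalType) (A B : set T) :
  open A -> A `&` B = set0 -> A `&` closure B = set0.
Proof.
move=> oA AB; rewrite -subset0 => x [Ax] /(_ A (open_nbhs_nbhs (conj oA Ax))).
by case=> y [By Ay]; have : set0 y by rewrite -AB.
Qed.

(** Each pair of related indices gets two disjoint open sets; the index a keeps
    the intersection of the finitely many sets that it was given. *)
Lemma separated_family_open (T : topologicalType) (I : finType)
    (e : I -> I -> Prop) (W : I -> set T) :
  completely_normal_space T ->
  (forall a b, e a b -> e b a) ->
  (forall a b, e a b -> separated (W a) (W b)) ->
  exists O : I -> set T,
    [/\ forall a, open (O a), forall a, W a `<=` O a &
        forall a b, e a b -> O a `&` O b = set0].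
Proof.
move=> cnT esym Wsep.
have /choice[UV UVP] : forall p : I * I, exists UV : set T * set T,
    [/\ open UV.1, open UV.2, W p.1 `<=` UV.1, W p.2 `<=` UV.2 &
        e p.1 p.2 -> UV.1 `&` UV.2 = set0].
  move=> [a b]; have [eab|neab] := pselect (e a b); last first.
    by exists (setT, setT); split=> //=; exact: openT.
  by have [U [V [? ? ? ? ?]]] := cnT _ _ (Wsep a b eab); exists (U, V).
exists (fun a => [set x | forall b, ((UV (a, b)).1 `&` (UV (b, a)).2) x]).
split.
- move=> a; apply: open_forall => b; apply: openI.
    by have [] := UVP (a, b).
  by have [] := UVP (b, a).
- move=> a x Wx b; split.
    by have [_ _ + _ _] := UVP (a, b); apply.
  by have [_ _ _ + _] := UVP (b, a); apply.
- move=> a b eab; rewrite -subset0 => x [/(_ b)[Ux _] /(_ a)[_ Vx]].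
  by have [_ _ _ _ <-] := UVP (a, b).
Qed.

(** Distinct colours of equal rank differ in both directions (exchange a and b
    in the hypothesis on r), which is what makes their classes separated and
    not merely disjoint. *)
Lemma ranked_open_family (T : topologicalType) (I : finType) (J : Type)
    (c : T -> I) (h : J -> I -> nat) (r : I -> nat) (G : I -> set T) :
  completely_normal_space T ->
  (forall j v, open [set x | (h j (c x) <= v)%N]) ->
  (forall a b, a <> b -> r a = r b -> exists j, (h j a < h j b)%N) ->
  (forall a, open (G a)) -> (forall x, G (c x) x) ->
  exists O : I -> set T,
    [/\ forall a, open (O a), forall x, O (c x) x,
        forall a, O a `<=` G a &
        forall a b, a <> b -> r a = r b -> O a `&` O b = set0].
Proof.
move=> cnT lo hr oG cG.
have half a b : a <> b -> r a = r b ->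
    [set x | c x = a] `&` closure [set x | c x = b] = set0.
  move=> ab rab; have [j hj] := hr a b ab rab.
  rewrite -subset0 => x [cx].
  rewrite -(open_disjoint_closure (B := [set x | c x = b]) (lo j (h j a))).
    by move=> clx; split=> //; rewrite /= cx.
  by rewrite -subset0 => y [/= + cy]; rewrite cy leqNgt hj.
have [||O [oO WO dO]] := @separated_family_open T I
  (fun a b => a <> b /\ r a = r b) (fun a => [set x | c x = a]) cnT.
- by move=> a b [ab rab]; split=> // ba; apply: ab.
- move=> a b [ab rab]; split; last exact: half.
  by rewrite setIC; apply: half => // ba; apply: ab.
exists (fun a => O a `&` G a); split.
- by move=> a; exact: openI.
- by move=> x; split=> //; exact: WO.
- by move=> a x [].
- move=> a b ab rab; rewrite -subset0 => x [[Oa _] [Ob _]].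
  by rewrite -(dO a b (conj ab rab)).
Qed.

(** The union may be empty; a section over it is then still a total map into
    the path space, and k > 0 provides a constant path. *)
Lemma path_section_disjoint (R : realType) (k : nat) (X : topologicalType)
    (k0 : (0 < k)%N) (I : finType) (P : set I) (O : I -> set {ptws 'I_k -> X}) :
  (forall a, open (O a)) -> (forall a, path_section R (O a)) ->
  (forall a b, P a -> P b -> a <> b -> O a `&` O b = set0) ->
  path_section R (\bigcup_(a in P) O a).
Proof.
move=> oO secO dO.
have [[a0 Pa0]|nP] := pselect (exists a, P a); last first.
  have -> : \bigcup_(a in P) O a = set0.
    by rewrite -subset0 => x [a Pa]; case: nP; exists a.
  apply: (@joint_path_section _ _ _ _ (fun x _ => x (Ordinal k0))) => //.
  exact: open0.
have /choice[s sP] := secO.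
have /choice[c cP] : forall x, exists a, (\bigcup_(a in P) O a) x -> P a /\ O a x.
  move=> x; have [[a Pa Oa]|nx] := pselect ((\bigcup_(a in P) O a) x).
    by exists a.
  by exists a0.
have oU : open (\bigcup_(a in P) O a) by apply: bigcup_open => a _.
exists (fun x => s (c x) x); split; last first.
  by move=> x /cP[_ Ox]; have [_] := sP (c x); exact.
rewrite continuous_open_subspace// => x /set_mem Ux.
have [Pa Oa] := cP x Ux.
have sc : {for x, continuous (s (c x))}.
  have [+ _] := sP (c x); rewrite continuous_open_subspace//; apply.
  exact: mem_set.
apply: near_eq_continuous_at sc.
have : nbhs x (O (c x)) by exact: open_nbhs_nbhs.
apply: filterS => y Oy; have [Pb Ob] := cP y (ex_intro2 _ _ (c x) Pa Oy).
have [->//|/eqP cxy] := eqVneq (c x) (c y).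
have : set0 y by rewrite -(dO _ _ Pa Pb cxy).
by [].
Qed.

(** * The quotient of M * S^1 and its local lifts *)

Section circle_quotient.
Variables (R : realType) (M : topologicalType) (tau : M -> M).
Hypotheses (tau_cont : continuous tau) (tau_inv : involutive tau).

Local Notation S1 := (set_type (@circle R)).
Local Notation X := (proj_prod tau (@antipode R)).

(** The nontrivial deck transformation of the double cover M * S^1 -> X. *)
Definition deck (y : M * S1) : M * S1 := (tau y.1, antipode y.2).

Definition class_of (y : M * S1) : X := (\pi_X y)%qT.

Lemma antipodeK : involutive (@antipode R).
Proof. by move=> z; apply: val_inj; rewrite /= opprK. Qed.

Lemma deckK : involutive deck.
Proof. by case=> x z; rewrite /deck /= tau_inv antipodeK. Qed.

(** The generated equivalence relation has classes of at most two points since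
    [deck] is an involution. *)
Lemma class_ofP (y y' : M * S1) :
  class_of y = class_of y' <-> y' = y \/ y' = deck y.
Proof.
split.
  move/eqquotP/asboolP; elim => {y y'}.
  - by move=> y y' ->; right.
  - by move=> y; left.
  - move=> y y' _ [->|->]; first by left.
    by right; rewrite deckK.
  - move=> y y' z _ [->|->] _ [->|->]; rewrite ?deckK; by [left|right].
case=> ->//; apply/eqquotP/asboolP; exact: Relation_Operators.rst_step.
Qed.

Lemma class_of_deck y : class_of (deck y) = class_of y.
Proof. by apply/esym/class_ofP; right. Qed.

Lemma repr_class_of (p : X) : class_of (repr p) = p.
Proof. exact: reprK. Qed.

Lemma class_of_continuous : continuous class_of.
Proof. exact: pi_continuous. Qed.

Lemma antipode_continuous : continuous (@antipode R).
Proof.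
apply: continuous_comp_initial => z.
have zc : {for z, continuous (val : S1 -> R * R)} by exact: initial_continuous.
apply: (@continuous_comp _ _ _ (val : S1 -> R * R) -%R z zc).
exact: opp_continuous.
Qed.

Lemma deck_continuous : continuous deck.
Proof.
move=> y.
apply: (@continuous_at_pair _ _ _ (tau \o fst) (@antipode R \o snd) y).
  apply: continuous_comp; [exact: cvg_fst|exact: tau_cont].
apply: continuous_comp; [exact: cvg_snd|exact: antipode_continuous].
Qed.

(** The saturation of an open set is its union with its translate. *)
Lemma class_of_open (A : set (M * S1)) : open A -> open (class_of @` A).
Proof.
move=> oA.
have -> : class_of @` A = [set p | exists y, A y /\ class_of y = p].
  by apply/seteqP; split=> p [y]; [exists y|case; exists y].
rewrite /open/= /quotient_open.
have -> : (\pi_X @^-1` [set p | exists y, A y /\ class_of y = p])%qT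
    = A `|` (deck @^-1` A).
  apply/seteqP; split=> y /=.
    case=> y' [Ay' /class_ofP[->|->]]; first by left.
    by right; rewrite /preimage /= deckK.
  by case=> Ay; [exists y|exists (deck y); rewrite class_of_deck].
apply: openU => //; apply: open_comp => // y _; exact: deck_continuous.
Qed.

Definition half_coord (b : bool) (z : S1) : R := if b then (val z).1 else (val z).2.

Lemma half_coord_continuous b : continuous (half_coord b).
Proof.
move=> z; have zc : {for z, continuous (val : S1 -> R * R)}.
  exact: initial_continuous.
by case: b; [exact: continuous_at_fst zc|exact: continuous_at_snd zc].
Qed.

Lemma half_coord_antipode b z : half_coord b (antipode z) = - half_coord b z.
Proof. by case: b. Qed.

Definition over_arc (b : bool) : set X :=
  class_of @` [set y | 0 < half_coord b y.2].

Lemma open_arc_dom b : open [set y : M * S1 | 0 < half_coord b y.2].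
Proof.
apply: (@open_comp _ _ (half_coord b \o snd) [set t | 0 < t]).
  move=> y _; apply: continuous_comp; [exact: cvg_snd|exact: half_coord_continuous].
exact: open_gt.
Qed.

Lemma open_over_arc b : open (over_arc b).
Proof. exact/class_of_open/open_arc_dom. Qed.

(** No point of the circle has both coordinates zero. *)
Lemma over_arc_cover p : over_arc true p \/ over_arc false p.
Proof.
rewrite -(repr_class_of p); case: (repr p) => x z {p}.
(* Whichever sign the coordinate has, one of the two representatives is in the
   half circle. *)
have side b : half_coord b z != 0 -> over_arc b (class_of (x, z)).
  move=> z0; have [zp|zn|z00] := ltgtP 0 (half_coord b z).
  - by exists (x, z).
  - by exists (deck (x, z)); rewrite ?class_of_deck//= half_coord_antipode oppr_gt0.
  - by rewrite -z00 eqxx in z0.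
have [z10|z1] := eqVneq (half_coord true z) 0; last by left; exact: side.
right; apply: side; apply/eqP => z20.
have := set_valP z; rewrite /circle /= [(_ z).1]z10 [(_ z).2]z20.
by rewrite expr0n /= addr0 => /esym/eqP; rewrite oner_eq0.
Qed.

Definition lift_arc (b : bool) (p : X) : M * S1 :=
  if 0 < half_coord b (repr p).2 then repr p else deck (repr p).

Lemma lift_arcK b p : class_of (lift_arc b p) = p.
Proof.
by rewrite /lift_arc; case: ifP => _; rewrite ?class_of_deck repr_class_of.
Qed.

Lemma lift_arc_class b y : 0 < half_coord b y.2 -> lift_arc b (class_of y) = y.
Proof.
move=> y0; rewrite /lift_arc.
have /class_ofP[<-|yE] := repr_class_of (class_of y); first by rewrite y0.
have : ~~ (0 < half_coord b (repr (class_of y)).2).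
  rewrite -(deckK (repr (class_of y))) -yE /= half_coord_antipode.
  by rewrite oppr_gt0 -leNgt ltW.
by move=> /negbTE ->.
Qed.

Lemma lift_arc_gt0 b p : over_arc b p -> 0 < half_coord b (lift_arc b p).2.
Proof. by case=> y y0 <-; rewrite lift_arc_class. Qed.

(** Near p, the lift is the inverse of the open map [class_of] on the open set
    where it is injective. *)
Lemma lift_arc_continuous b p : over_arc b p -> {for p, continuous (lift_arc b)}.
Proof.
case=> y y0 <- B; rewrite lift_arc_class// nbhsE => -[W [oW Wy] WB].
have : nbhs (class_of y) (class_of @` (W `&` [set y | 0 < half_coord b y.2])).
  apply: open_nbhs_nbhs; split; last by exists y.
  by apply: class_of_open; apply: openI => //; exact: open_arc_dom.
apply: filterS => _ [y' [Wy' y'0] <-] /=.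
by rewrite lift_arc_class//; exact: WB.
Qed.

Lemma lift_arc_repr b p :
  (lift_arc b p).1 = (repr p).1 \/ (lift_arc b p).1 = tau (repr p).1.
Proof. by rewrite /lift_arc; case: ifP => _; [left|right]. Qed.

End circle_quotient.

(** * Paths in the circle through prescribed points *)

Section tents.
Variables (R : realType) (k : nat).
Hypothesis hk : (2 <= k)%N.
Implicit Types (i j : 'I_k) (t : R).

(** Twice the distance from t to the node j / (k - 1), measured in units of
    1 / (k - 1): it is 0 at the node and 1 half-way to its neighbours. *)
Definition node_dist j t : R := 2 * `|t * k.-1%:R - j%:R|.

Lemma node_dist_continuous j : continuous (node_dist j).
Proof.
move=> t; apply: cvgM; first exact: cvg_cst.
apply: cvg_norm; apply: cvgB; last exact: cvg_cst.
by apply: cvgM; [exact: cvg_id|exact: cvg_cst].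
Qed.

Lemma node_dist_ge0 j t : 0 <= node_dist j t.
Proof. by rewrite mulr_ge0. Qed.

Lemma ord_dist i j : i != j -> 1 <= `|i%:R - j%:R : R|.
Proof.
wlog : i j / (i < j)%N => [wl|ij _].
  move=> ij; have : (i : nat) != j by [].
  rewrite neq_ltn => /orP[] lt; first exact: wl.
  by rewrite distrC; apply: wl => //; rewrite eq_sym.
have : i.+1%:R <= j%:R :> R by rewrite ler_nat.
by rewrite -natr1 distrC => ?; apply: le_trans (ler_norm _); lra.
Qed.

Lemma node_dist_uniq i j t :
  node_dist i t <= 1 -> node_dist j t <= 1 -> i != j ->
  node_dist i t = 1 /\ node_dist j t = 1.
Proof.
rewrite /node_dist => di dj /ord_dist dij.
have := ler_distD (t * k.-1%:R) i%:R (j%:R : R).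
by rewrite (distrC i%:R (t * _)); split; lra.
Qed.

Lemma node_dist_node i j :
  node_dist j (val (unit_node R i)) = 2 * `|i%:R - j%:R|.
Proof.
rewrite /node_dist /= divfK// pnatr_eq0; by case: k hk => [|[|]].
Qed.

Lemma node_dist_exists (t : unit_interval R) :
  exists j, node_dist j (val t) <= 1.
Proof.
have /andP[t0 t1] := val_unit_itv t.
set x := val t * k.-1%:R.
have x0 : 0 <= x by rewrite mulr_ge0.
have xk : x <= k.-1%:R by rewrite /x ler_piMl.
have near_nat n : x <= n%:R -> exists2 m : nat, (m <= n)%N & `|x - m%:R| <= 1 / 2.
  elim: n => [|n IHn] xn.
    by exists 0 => //; have -> : x = 0 by [lra]; rewrite subrr normr0.
  have [/IHn[m mn xm]|nx] := leP x n%:R; first by exists m => //; exact: leqW.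
  rewrite -natr1 in xn; have [xl|xg] := leP x (n%:R + 1 / 2).
    by exists n => //; rewrite ler_norml; lra.
  by exists n.+1 => //; rewrite -natr1 ler_norml; lra.
have [m mk xm] := near_nat _ xk.
have mk' : (m < k)%N by case: k hk mk.
by exists (Ordinal mk'); rewrite /node_dist /= -/x; lra.
Qed.

Definition tent j t : R := Num.max 0 (1 - node_dist j t).

Lemma tent_continuous j : continuous (tent j).
Proof.
move=> t; apply: (@continuous_max _ _ (fun=> 0) (fun t => 1 - node_dist j t)).
  exact: cvg_cst.
by apply: cvgB; [exact: cvg_cst|exact: node_dist_continuous].
Qed.

Lemma tent_ge0 j t : 0 <= tent j t.
Proof. by rewrite le_max lexx. Qed.

Lemma tent_le1 j t : tent j t <= 1.
Proof. by rewrite ge_max ler01 gerBl node_dist_ge0. Qed.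

Lemma tent_uniq i j t : 0 < tent i t -> i != j -> tent j t = 0.
Proof.
rewrite /tent lt_max ltxx /= subr_gt0 => di ij.
apply: max_l; rewrite subr_le0 leNgt; apply/negP => dj.
by have := node_dist_uniq (ltW di) (ltW dj) ij; lra.
Qed.

Lemma tent_node i : tent i (val (unit_node R i)) = 1.
Proof. by rewrite /tent node_dist_node subrr normr0 mulr0 subr0 max_r. Qed.

(** One coordinate of the planar path that runs out from 1 to a j and back,
    around the time of the j-th node. *)
Definition spoke (a : 'I_k -> R) t : R := 1 + \sum_j tent j t * (a j - 1).

(** The tents have disjoint supports, so at each time the spoke path is a point
    of a single segment from 1 to some a j, uniformly in a. *)
Lemma spokeP t :
  exists j, forall a, spoke a t = 1 + tent j t * (a j - 1).
Proof.
have [[j tj]|none] := pselect (exists j, 0 < tent j t).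
  exists j => a; rewrite /spoke (bigD1 j)//= big1 ?addr0// => i ij.
  by rewrite (tent_uniq tj) ?mul0r// eq_sym.
have k0 : (0 < k)%N by case: k hk.
exists (Ordinal k0) => a.
have t0 j : tent j t = 0.
  apply/eqP/negPn/negP => tj; apply: none; exists j.
  by rewrite lt_neqAle eq_sym tj tent_ge0.
by rewrite /spoke t0 big1 => [|j _]; rewrite ?t0 !mul0r.
Qed.

Lemma spoke_node a i : spoke a (val (unit_node R i)) = a i.
Proof.
rewrite /spoke (bigD1 i)//= big1 => [|j ij].
  by rewrite tent_node mul1r addr0 addrC subrK.
by rewrite (@tent_uniq i) ?mul0r ?tent_node// eq_sym.
Qed.

Lemma spoke_continuous (T : topologicalType) (a : T -> 'I_k -> R) (s : T -> R) x :
  (forall j, {for x, continuous (fun y => a y j)}) -> {for x, continuous s} ->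
  {for x, continuous (fun y => spoke (a y) (s y))}.
Proof.
move=> ac sc; apply: cvgD; first exact: cvg_cst.
apply: cvg_big => [|j _]; first exact: add_continuous.
apply: cvgM; first exact: (continuous_comp sc (@tent_continuous _ _)).
by apply: cvgB; [exact: ac|exact: cvg_cst].
Qed.

(** A segment from (1, 1) to a point of the open half plane selected by b j
    stays in that half plane. *)
Lemma spoke_neq0 (b : 'I_k -> bool) (z : 'I_k -> R * R) t :
  (forall j, 0 < if b j then (z j).1 else (z j).2) ->
  (spoke (fun j => (z j).1) t, spoke (fun j => (z j).2) t) != (0, 0).
Proof.
move=> zb; have [j jE] := spokeP t; rewrite !jE.
have cvx a : 0 < a -> 0 < 1 + tent j t * (a - 1).
  move=> a0; have t0 := tent_ge0 j t; have t1 := tent_le1 j t.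
  have [->|tn0] := eqVneq (tent j t) 0; first by rewrite mul0r addr0.
  have tp : 0 < tent j t by rewrite lt_neqAle eq_sym tn0.
  by have : 0 < tent j t * a by [exact: mulr_gt0]; nra.
rewrite xpair_eqE negb_and; move: (zb j).
by case: (b j) => /cvx /gt_eqF ->; rewrite ?orbT.
Qed.

End tents.

Section normalization.
Variable R : realType.

Lemma circle10 : (1, 0) \in (@circle R).
Proof. by apply/mem_set; rewrite /circle /= expr1n expr0n addr0. Qed.

Definition norm2 (w : R * R) : R := Num.sqrt (w.1 ^+ 2 + w.2 ^+ 2).

Lemma norm2_gt0 w : w != (0, 0) -> 0 < norm2 w.
Proof.
case: w => a b; rewrite xpair_eqE negb_and /norm2 sqrtr_gt0 /= => ab.
rewrite lt_neqAle addr_ge0 ?sqr_ge0// andbT eq_sym paddr_eq0 ?sqr_ge0//.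
by rewrite !sqrf_eq0 negb_and.
Qed.

Lemma norm2_continuous : continuous norm2.
Proof.
move=> w; apply: (@continuous_comp _ _ _ (fun w : R * R => w.1 ^+ 2 + w.2 ^+ 2)
  Num.sqrt); last exact: sqrt_continuous.
apply: cvgD; rewrite expr2.
  under eq_cvg do rewrite expr2.
  by apply: cvgM; exact: cvg_fst.
under eq_cvg do rewrite expr2.
by apply: cvgM; exact: cvg_snd.
Qed.

Definition normalize (w : R * R) : set_type (@circle R) :=
  insubd (exist _ (1, 0) circle10 : set_type (@circle R))
    (w.1 / norm2 w, w.2 / norm2 w).

Lemma val_normalize w : w != (0, 0) ->
  val (normalize w) = (w.1 / norm2 w, w.2 / norm2 w).
Proof.
move=> w0; rewrite /normalize insubdK//; apply/mem_set; rewrite /circle /=.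
have n0 := norm2_gt0 w0; rewrite !expr_div_n -mulrDl.
rewrite -[X in X / _](@sqr_sqrtr _ (w.1 ^+ 2 + w.2 ^+ 2)) ?addr_ge0 ?sqr_ge0//.
by rewrite -/(norm2 w) divff// expf_neq0// gt_eqF.
Qed.

Lemma normalizeK z : normalize (val z) = z.
Proof.
have zE : norm2 (val z) = 1.
  by have := set_valP z; rewrite /circle /norm2 /= => ->; rewrite sqrtr1.
apply: val_inj; rewrite val_normalize ?zE ?divr1; first by case: (val z).
apply/eqP => z0; move: zE; rewrite z0 /norm2 /= expr0n addr0 sqrtr0.
by move/eqP; rewrite eq_sym oner_eq0.
Qed.

Lemma normalize_continuous w : w != (0, 0) -> {for w, continuous normalize}.
Proof.
move=> w0 B [/= _ [[W oW <-] /= Ww WB]]; apply: (filterS WB) => {B WB}.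
have fc : {for w, continuous (fun w : R * R => (w.1 / norm2 w, w.2 / norm2 w))}.
  have nc : {for w, continuous (fun w => (norm2 w)^-1)}.
    apply: cvgV; last exact: norm2_continuous.
    by rewrite gt_eqF// norm2_gt0.
  apply: continuous_at_pair; apply: cvgM => //; [exact: cvg_fst|exact: cvg_snd].
have near0 : \forall w' \near w, w' != (0, 0).
  have : nbhs w (norm2 @^-1` [set t | 0 < t]).
    apply: norm2_continuous; apply: open_nbhs_nbhs.
    by split; [exact: open_gt|exact: norm2_gt0].
  apply: filterS => w' /=; apply: contraTneq => ->.
  by rewrite /norm2 /= expr0n addr0 sqrtr0 ltxx.
have : \forall w' \near w, W (w'.1 / norm2 w', w'.2 / norm2 w').
  by apply: fc; apply: open_nbhs_nbhs; split=> //; rewrite -val_normalize.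
by apply: filterS2 near0 => w' w'0; rewrite /= -val_normalize.
Qed.

End normalization.

(** * Covers of the powers of the quotient *)

Lemma eq_sum_ltn (J : finType) (f g : J -> nat) (j : J) :
  (\sum_i f i = \sum_i g i)%N -> f j != g j -> exists i, (f i < g i)%N.
Proof.
move=> fg fgj; apply: contrapT => nex.
have gf i : (g i <= f i)%N by rewrite leqNgt; apply/negP => ?; apply: nex; exists i.
move: fg; rewrite (bigD1 j)//= [RHS](bigD1 j)//= => fg.
have : (\sum_(i | i != j) g i <= \sum_(i | i != j) f i)%N by exact: leq_sum.
have : (g j < f j)%N by rewrite ltn_neqAle eq_sym fgj gf.
by lia.
Qed.

Lemma ltn_sum_exists (J : finType) (f g : J -> nat) :
  (\sum_i f i < \sum_i g i)%N -> exists i, (f i < g i)%N.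
Proof.
move=> fg; apply: contrapT => nex; move: fg; rewrite ltnNge => /negP; apply.
apply: leq_sum => i _; rewrite leqNgt; apply/negP => ?; apply: nex.
by exists i.
Qed.

Lemma first_index (T : Type) (n : nat) (U : 'I_n -> set T) :
  \bigcup_i U i = setT ->
  exists b : T -> 'I_n,
    (forall x, U (b x) x) /\ forall x i, U i x -> (b x <= i)%N.
Proof.
move=> Uc; suff /choice[b bP] : forall x, exists b : 'I_n,
    U b x /\ forall i, U i x -> (b <= i)%N.
  by exists b; split=> x; have [] := bP x.
move=> x; have [i0 _ Ui0] : (\bigcup_i U i) x by rewrite Uc.
have := @arg_minnP _ i0 (fun i => `[< U i x >]) (@nat_of_ord n) (asboolT Ui0).
case=> b /asboolP Ub bmin; exists b; split=> // i Ui; exact/bmin/asboolP.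
Qed.

(** The set is the union of the U i with i <= v. *)
Lemma first_index_open (T : topologicalType) (n : nat) (U : 'I_n -> set T)
    (b : T -> 'I_n) (v : nat) :
  (forall i, open (U i)) -> (forall x, U (b x) x) ->
  (forall x i, U i x -> (b x <= i)%N) -> open [set x | (b x <= v)%N].
Proof.
move=> oU Ub bmin.
have -> : [set x | (b x <= v)%N] = \bigcup_(i in [set i : 'I_n | (i <= v)%N]) U i.
  apply/seteqP; split=> x /=; first by exists (b x).
  by case=> i /= iv /bmin bi; exact: leq_trans iv.
by apply: bigcup_open => i _.
Qed.

Section flips.
Variables (M : topologicalType) (tau : M -> M).
Hypotheses (tau_cont : continuous tau) (tau_inv : involutive tau).

Lemma generated_group_id : generated_group tau id.
Proof. by move=> G [[_ ? _ _] _]. Qed.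

Lemma generated_group_gen : generated_group tau tau.
Proof. by move=> G [_]; apply. Qed.

(** Since tau is an involution, {id, tau} is a group. *)
Lemma generated_groupE g : generated_group tau g -> g = id \/ g = tau.
Proof.
move/(_ [set g | g = id \/ g = tau]); apply; split; last by move=> _ ->; right.
have tt : tau \o tau = id by apply/funext => x /=; rewrite tau_inv.
split.
- by move=> _ [->|->]; [move=> ?; exact: continuous_at_id|].
- by left.
- move=> _ _ [->|->] [->|->]; [by left|by right|by right|left].
  exact: tt.
- by move=> _ [->|->]; [exists id|exists tau]; split=> //; [left|right].
Qed.

(** Invariance under the k-th power of the group generated by tau, stated
    without the group: each coordinate may be replaced by its image. *)
Definition flip_invariant (k : nat) (U : set {ptws 'I_k -> M}) : Prop :=
  forall x y, (forall i, y i = x i \/ y i = tau (x i)) -> U x -> U y.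

Lemma invariant_power_groupE k (U : set {ptws 'I_k -> M}) :
  invariant_set (power_group k (generated_group tau)) U <-> flip_invariant U.
Proof.
split=> [inv x y xy Ux|inv g [h [hG ->]] x].
  pose h i := if `[< y i = x i >] then id else tau.
  have -> : y = (fun i => h i (x i)).
    by apply/funext => i; rewrite /h; case: asboolP => //; case: (xy i).
  apply: (inv (fun x i => h i (x i))) => //; exists h; split=> // i.
  by rewrite /h; case: asboolP => _;
    [exact: generated_group_id|exact: generated_group_gen].
by apply: inv => i; have [->|->] := generated_groupE (hG i); [left|right].
Qed.

End flips.

Section planner.
Variables (R : realType) (k : nat) (M : topologicalType) (tau : M -> M).
Hypotheses (hk : (2 <= k)%N) (tau_cont : continuous tau)
  (tau_inv : involutive tau).

Local Notation S1 := (set_type (@circle R)).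
Local Notation X := (proj_prod tau (@antipode R)).

Definition fiber_coords (a : 'I_k -> bool) (p : {ptws 'I_k -> X}) :
    {ptws 'I_k -> M} := fun j => (lift_arc (a j) (p j)).1.

Definition circle_coords (a : 'I_k -> bool) (p : {ptws 'I_k -> X}) (j : 'I_k) :
  S1 := (lift_arc (a j) (p j)).2.

Definition arcs (a : 'I_k -> bool) : set {ptws 'I_k -> X} :=
  [set p | forall j, over_arc (a j) (p j)].

Lemma lift_coord_continuous a p j : arcs a p ->
  {for p, continuous (fun q : {ptws 'I_k -> X} => lift_arc (a j) (q j))}.
Proof.
move=> ap; apply: (@continuous_comp _ _ _ (fun q : {ptws 'I_k -> X} => q j)
  (lift_arc (a j))).
  exact: ptws_proj_continuous.
exact: lift_arc_continuous.
Qed.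

Lemma fiber_coords_continuous a p : arcs a p ->
  {for p, continuous (fiber_coords a)}.
Proof.
move=> ap; apply: continuous_at_ptws => j.
exact/continuous_at_fst/lift_coord_continuous.
Qed.

Lemma circle_coords_continuous a p j : arcs a p ->
  {for p, continuous (fun q => circle_coords a q j)}.
Proof. by move=> ap; exact/continuous_at_snd/lift_coord_continuous. Qed.

Lemma open_arcs a : open (arcs a).
Proof.
apply: open_forall => j; apply: (@open_comp _ _ (fun p : {ptws 'I_k -> X} => p j)).
  by move=> p _; exact: ptws_proj_continuous.
exact: open_over_arc.
Qed.

Definition total_space (U : set {ptws 'I_k -> M}) : set {ptws 'I_k -> X} :=
  [set p | U (fun j => (repr (p j)).1)].

(** Two lifts of a point of X^k differ by a flip of some coordinates, which the
    invariance of U absorbs. *)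
Lemma total_spaceE a U p : flip_invariant tau U ->
  total_space U p <-> U (fiber_coords a p).
Proof.
move=> inv; split; apply: inv => j; rewrite /fiber_coords.
  exact: lift_arc_repr.
by have [->|->] := lift_arc_repr (a j) (p j); [left|right; rewrite tau_inv].
Qed.

(** The choice of representatives is not continuous, but near a given point it
    may be replaced by a local lift. *)
Lemma open_total_space U : open U -> flip_invariant tau U ->
  open (total_space U).
Proof.
move=> oU inv; rewrite openE => p Up.
pose a (j : 'I_k) := `[< over_arc true (p j) >].
have ap : arcs a p.
  move=> j; rewrite /a; case: asboolP => // npj.
  by have [] := over_arc_cover tau_inv (p j).
have : \forall q \near p, U (fiber_coords a q).
  apply: (fiber_coords_continuous ap); apply: open_nbhs_nbhs; split=> //.
  exact/total_spaceE.
by apply: filterS => q /(total_spaceE _ _ inv).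
Qed.

(** The motion planner on one colour: the section over U moves the fibre
    coordinate, the normalized spoke path moves the circle coordinate, and the
    result is projected to X. *)
Lemma path_section_arcs a U : open U -> flip_invariant tau U ->
  path_section R U -> path_section R (arcs a `&` total_space U).
Proof.
move=> oU inv [s [sc sE]].
pose w (p : {ptws 'I_k -> X}) (t : R) : R * R :=
  (spoke (fun j => (val (circle_coords a p j)).1) t,
   spoke (fun j => (val (circle_coords a p j)).2) t).
apply: (@joint_path_section R k X _ (fun p t =>
  class_of tau (s (fiber_coords a p) t, normalize (w p (val t))))).
- by apply: openI; [exact: open_arcs|exact: open_total_space].
- move=> p t [ap /(total_spaceE a _ inv) Up].
  apply: (@continuous_comp _ _ _ (fun q : {ptws 'I_k -> X} * unit_interval R =>
    (s (fiber_coords a q.1) q.2, normalize (w q.1 (val q.2)))) (@class_of R M tau));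
    last exact: class_of_continuous.
  apply: continuous_at_pair.
    apply: (@continuous_comp _ _ _ (fun q : {ptws 'I_k -> X} * unit_interval R =>
      (fiber_coords a q.1, q.2)) (fun q => s q.1 q.2)).
      apply: continuous_at_pair; last exact/continuous_at_snd/continuous_at_id.
      apply: (@continuous_comp _ _ _ fst (fiber_coords a)).
        exact/continuous_at_fst/continuous_at_id.
      exact: fiber_coords_continuous.
    apply: path_space_uncurry.
    by move: sc; rewrite continuous_open_subspace//; apply; exact: mem_set.
  apply: (@continuous_comp _ _ _ (fun q : {ptws 'I_k -> X} * unit_interval R =>
    w q.1 (val q.2)) (@normalize R)); last first.
    apply: normalize_continuous; apply: (spoke_neq0 hk (b := a)) => j.
    exact: (lift_arc_gt0 tau_inv (ap j)).
  have cc j : {for (p, t), continuous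
      (fun q : {ptws 'I_k -> X} * unit_interval R => val (circle_coords a q.1 j))}.
    apply: (@continuous_comp _ _ _ fst
      (fun q : {ptws 'I_k -> X} => val (circle_coords a q j))).
      exact/continuous_at_fst/continuous_at_id.
    apply: (@continuous_comp _ _ _ (fun q => circle_coords a q j)
      (val : S1 -> R * R)).
      exact: circle_coords_continuous.
    exact: initial_continuous.
  have tc : {for (p, t), continuous
      (fun q : {ptws 'I_k -> X} * unit_interval R => val q.2)}.
    apply: (@continuous_comp _ _ _ snd (val : unit_interval R -> R)).
      exact/continuous_at_snd/continuous_at_id.
    exact: val_unit_continuous.
  pose T := ({ptws 'I_k -> X} * unit_interval R)%type.
  pose c1 (q : T) (j : 'I_k) : R := (val (circle_coords a q.1 j)).1.
  pose c2 (q : T) (j : 'I_k) : R := (val (circle_coords a q.1 j)).2.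
  pose time (q : T) : R := val q.2.
  have w1 : {for (p, t), continuous (fun q : T => spoke (c1 q) (time q))}.
    by apply: (@spoke_continuous _ _ _ c1 time _ _ tc) => j;
      exact: (continuous_at_fst (cc j)).
  have w2 : {for (p, t), continuous (fun q : T => spoke (c2 q) (time q))}.
    by apply: (@spoke_continuous _ _ _ c2 time _ _ tc) => j;
      exact: (continuous_at_snd (cc j)).
  exact: continuous_at_pair w1 w2.
- move=> p i [ap /(total_spaceE a _ inv) Up].
  have -> : s (fiber_coords a p) (unit_node R i) = fiber_coords a p i.
    by have := congr1 (fun f : {ptws 'I_k -> M} => f i) (sE _ Up).
  rewrite /w !spoke_node// -surjective_pairing normalizeK.
  by rewrite -surjective_pairing lift_arcK.
Qed.

End planner.

(** The colour of p records, for each coordinate, whether p j fails to lie over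
    the half circle z.1 > 0, and the first index i with p in V i.  The bit 0 is
    given to an open condition, as [ranked_open_family] requires. *)
Lemma TC_cover (R : realType) (k : nat) (hk : (2 <= k)%N)
    (M : topologicalType) (tau : M -> M) (tau_cont : continuous tau)
    (tau_inv : involutive tau) (n : nat) (U : 'I_n -> set {ptws 'I_k -> M}) :
  completely_normal_space {ptws 'I_k -> proj_prod tau (@antipode R)} ->
  (forall i, [/\ open (U i), flip_invariant tau (U i) & path_section R (U i)]) ->
  \bigcup_i U i = setT ->
  exists V : 'I_(k + n) -> set {ptws 'I_k -> proj_prod tau (@antipode R)},
    (forall s, open (V s) /\ path_section R (V s)) /\ \bigcup_s V s = setT.
Proof.
set X := proj_prod tau (@antipode R).
move=> cnX UP Uc.
have oU i : open (U i) by have [] := UP i.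
have invU i : flip_invariant tau (U i) by have [] := UP i.
pose V i : set {ptws 'I_k -> X} := total_space (U i).
have oV i : open (V i).
  exact: open_total_space.
have [|b [Vb bmin]] := first_index (U := fun i => V i).
  rewrite -subTset => p _; have [i _ Ui] : (\bigcup_i U i) (fun j => (repr (p j)).1).
    by rewrite Uc.
  by exists i.
pose I := ({ffun 'I_k -> bool} * 'I_n)%type.
pose c (p : {ptws 'I_k -> X}) : I := ([ffun j => ~~ `[< over_arc true (p j) >]], b p).
pose h (j : option 'I_k) (a : I) : nat :=
  if j is Some j then a.1 j : nat else a.2 : nat.
pose r (a : I) : nat := (\sum_j a.1 j + a.2)%N.
pose G (a : I) : set {ptws 'I_k -> X} := arcs (fun j => ~~ a.1 j) `&` V a.2.
have [||||O [oO cO OG dO]] := @ranked_open_family _ I (option 'I_k) c h r G cnX.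
- move=> [j|] v /=; last exact: first_index_open.
  have [v0|v1] := posnP v; last first.
    rewrite (_ : mkset _ = setT); first exact: openT.
    by rewrite -subTset => p _ /=; rewrite (leq_trans (leq_b1 _)).
  rewrite (_ : mkset _ = [set p : {ptws 'I_k -> X} | over_arc true (p j)]).
    apply: (@open_comp _ _ (fun p : {ptws 'I_k -> X} => p j) (over_arc true)).
      by move=> p _; exact: ptws_proj_continuous.
    exact: open_over_arc.
  apply/seteqP; split=> p /=; rewrite v0 ffunE; first by case: asboolP.
  by case: asboolP.
- move=> [a i] [a' i'] ne; rewrite /r /= => rE.
  have [lt|gt|eqi] := ltngtP i i'; first by exists None.
    have : (\sum_j a j < \sum_j a' j)%N by rewrite -(ltn_add2r i') -rE ltn_add2l.
    by case/ltn_sum_exists => j ltj; exists (Some j).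
  have [j nej] : exists j, a j != a' j.
    apply: contrapT => nex; apply: ne; congr pair; last exact: val_inj.
    by apply/ffunP => j; apply/eqP/negPn/negP => nj; apply: nex; exists j.
  move: rE; rewrite eqi => /addIn aE.
  have nj : (a j : nat) != (a' j : nat) by case: (a j) (a' j) nej => -[].
  by have [j' ltj] := eq_sum_ltn aE nj; exists (Some j').
- by move=> a; apply: openI => //; exact: open_arcs.
- move=> p; split; last exact: Vb.
  move=> j /=; rewrite ffunE negbK; case: asboolP => // np.
  by have [] := over_arc_cover tau_inv (p j).
have secO a : path_section R (O a).
  have [s [sc sE]] : path_section R (G a).
    by apply: path_section_arcs => //; have [] := UP a.2.
  exists s; split; last by move=> x /OG; exact: sE.
  exact: continuous_subspaceW sc.
have rlt a : (r a < k + n)%N.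
  rewrite /r -addnS leq_add ?ltn_ord//.
  apply: leq_trans (_ : \sum_(j < k) 1 <= _)%N; last by rewrite sum1_card card_ord.
  by apply: leq_sum => j _; exact: leq_b1.
exists (fun s => \bigcup_(a in [set a | r a = s]) O a); split.
  move=> s; split; first by apply: bigcup_open => a _.
  apply: path_section_disjoint => //; first exact: ltnW.
  by move=> a a' /= ra ra' ne; apply: dO => //; rewrite ra ra'.
rewrite -subTset => p _; exists (Ordinal (rlt (c p))) => //.
by exists (c p).
Qed.

(** * Covers of the powers of the fibre *)

(** It suffices that r be continuous at the points of the image of i: then i
    sends separated sets to separated sets. *)
Lemma completely_normal_retract (S T : topologicalType) (i : S -> T)
    (r : T -> S) :
  completely_normal_space T -> continuous i -> cancel i r ->
  (forall s, {for i s, continuous r}) -> completely_normal_space S.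
Proof.
move=> cnT ic ir rc.
have clE (A : set S) s : closure (i @` A) (i s) -> closure A s.
  move=> cl N Ns; have Nrs : nbhs (i s) (r @^-1` N) by apply: rc; rewrite ir.
  by have [_ [[a Aa <-] /=]] := cl _ Nrs; rewrite ir; exists a.
move=> A B [clAB AclB].
have [|U [V [oU oV AU BV UV]]] := cnT (i @` A) (i @` B).
  split; rewrite -subset0 => t.
    case=> ct [b Bb bt]; rewrite -bt in ct.
    by have : set0 b by rewrite -clAB; split=> //; exact: clE.
  case=> -[a Aa at_] ct; rewrite -at_ in ct.
  by have : set0 a by rewrite -AclB; split=> //; exact: clE.
exists (i @^-1` U), (i @^-1` V); split.
- by apply: open_comp => // s _; exact: ic.
- by apply: open_comp => // s _; exact: ic.
- by move=> s As; apply: AU; exists s.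
- by move=> s Bs; apply: BV; exists s.
- by rewrite -preimage_setI UV preimage_set0.
Qed.

Lemma completely_normal_fiber (R : realType) (k : nat) (M : topologicalType)
    (tau : M -> M) :
  continuous tau -> involutive tau ->
  completely_normal_space {ptws 'I_k -> proj_prod tau (@antipode R)} ->
  completely_normal_space {ptws 'I_k -> M}.
Proof.
move=> tau_cont tau_inv cnX.
pose e := normalize ((1, 0) : R * R).
have e0 : 0 < half_coord true e.
  pose z : set_type (@circle R) := exist _ (1, 0) (circle10 R).
  rewrite /half_coord /e (_ : (1, 0) = val z)//.
  by rewrite normalizeK /= ltr01.
pose i (x : {ptws 'I_k -> M}) : {ptws 'I_k -> proj_prod tau (@antipode R)} :=
  fun j => class_of tau (x j, e).
apply: (@completely_normal_retract _ _ i (fiber_coords (fun=> true)) cnX).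
- move=> x; apply: continuous_at_ptws => j.
  apply: (@continuous_comp _ _ _ (fun x : {ptws 'I_k -> M} => (x j, e))
    (@class_of R M tau)); last exact: class_of_continuous.
  apply: continuous_at_pair; last exact: continuous_at_cst.
  exact: ptws_proj_continuous.
- by move=> x; apply/funext => j; rewrite /fiber_coords lift_arc_class.
- move=> x; apply: fiber_coords_continuous => // j.
  by exists (x j, e).
Qed.

Lemma clamp0 (R : realType) : clamp (0 : R) = unit0 R.
Proof. by rewrite -[unit0 R]clampK val_unit0. Qed.

Lemma clamp1 (R : realType) : clamp (1 : R) = unit1 R.
Proof. by rewrite -[unit1 R]clampK val_unit1. Qed.

(** The null-homotopy, run at double speed, followed by a path from its end
    point c to m, so that all the contractions end at the same point. *)
Lemma contraction_to (R : realType) (M : topologicalType) (U : set M) (m : M) :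
  path_connected_space R M -> open U -> null_homotopic_inclusion R U ->
  exists K : M -> R -> M, forall x, U x ->
    [/\ K x 0 = x, K x 1 = m &
        forall t, {for (x, t), continuous (fun p => K p.1 p.2)}].
Proof.
move=> [_ pc] oU [H [c [Hc H0 H1]]].
have [g [g0 g1]] := pc c m.
pose K1 (p : M * R) := H (p.1, clamp (2 * p.2)).
pose K2 (p : M * R) := g (clamp (2 * p.2 - 1)).
exists (fun x t => if t <= 1 / 2 then K1 (x, t) else K2 (x, t)) => x Ux; split.
- by rewrite ifT /K1 /= ?mulr0 ?clamp0 ?H0//; lra.
- rewrite ifF /K2 /=; last by apply/negbTE; rewrite -ltNge; lra.
  by rewrite (_ : 2 * 1 - 1 = 1) ?clamp1//; lra.
move=> t.
have c2 : continuous (fun p : M * R => 2 * p.2).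
  by move=> p; apply: cvgM; [exact: cvg_cst|exact: cvg_snd].
apply: (@finite_pasting _ _ bool
  (fun b => [set p : M * R | if b then p.2 <= 1 / 2 else 1 / 2 <= p.2])
  (fun b p => if b then K1 p else K2 p)) => //.
- case.
    apply: (@closed_comp _ _ (snd : M * R -> R) [set t | t <= 1 / 2]).
      by move=> p _; exact: cvg_snd.
    exact: closed_le.
  apply: (@closed_comp _ _ (snd : M * R -> R) [set t | 1 / 2 <= t]).
    by move=> p _; exact: cvg_snd.
  exact: closed_ge.
- case=> y u /=; have [ul|ug] := leP u (1 / 2); first by exists true.
  by exists false => //=; exact: ltW.
- case=> /= tE; split.
  + apply: (@continuous_comp _ _ _ (fun p : M * R => (p.1, clamp (2 * p.2))) H).
      apply: continuous_at_pair; first exact: cvg_fst.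
      apply: (@continuous_comp _ _ _ (fun p : M * R => 2 * p.2) (@clamp R)).
        exact: c2.
      exact: clamp_continuous.
    move: Hc; rewrite continuous_open_subspace; last first.
      rewrite openE => -[y u] [/= Uy _]; exists (U, setT) => //=.
      by split; [exact: open_nbhs_nbhs|exact: filterT].
    by apply; apply/mem_set.
  + by rewrite tE.
  + apply: (@continuous_comp _ _ _ (fun p : M * R => clamp (2 * p.2 - 1)) g).
      apply: (@continuous_comp _ _ _ (fun p : M * R => 2 * p.2 - 1) (@clamp R)).
        by apply: cvgB; [exact: c2|exact: cvg_cst].
      exact: clamp_continuous.
    exact: cts_fun.
  + case: ifP => // tl; have -> : t = 1 / 2 by apply/le_anti; rewrite tE tl.
    rewrite /K1 /K2 /= (_ : 2 * (1 / 2) - 1 = 0); last by lra.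
    by rewrite (_ : 2 * (1 / 2) = 1) ?clamp0 ?clamp1 ?H1//; lra.
Qed.

Definition box (M : topologicalType) (k n : nat) (U : 'I_n -> set M)
    (a : 'I_k -> 'I_n) : set {ptws 'I_k -> M} :=
  [set x | forall j, U (a j) (x j)].

Lemma open_box (M : topologicalType) (k n : nat) (U : 'I_n -> set M)
    (a : 'I_k -> 'I_n) : (forall i, open (U i)) -> open (box U a).
Proof.
move=> oU; apply: open_forall => j.
apply: (@open_comp _ _ (fun p : {ptws 'I_k -> M} => p j)) => //.
by move=> p _; exact: ptws_proj_continuous.
Qed.

(** Near the j-th node the path retraces the contraction of x j, read from the
    distance to the node.  Half-way between two nodes both neighbouring
    contractions have reached m, so the pieces agree there. *)
Lemma path_section_box (R : realType) (M : topologicalType) (k n : nat)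
    (U : 'I_n -> set M) (a : 'I_k -> 'I_n) :
  (2 <= k)%N -> path_connected_space R M -> (forall i, open (U i)) ->
  (forall i, null_homotopic_inclusion R (U i)) ->
  path_section R (box U a).
Proof.
move=> hk pcM oU nU.
have [[m _] _] := pcM.
have /choice[K KP] := fun i => contraction_to m pcM (oU i) (nU i).
have /choice[near_node nodeP] := fun t => @node_dist_exists R k hk t.
pose T := ({ptws 'I_k -> M} * unit_interval R)%type.
pose f (j : 'I_k) (p : T) : M := K (a j) (p.1 j) (node_dist j (val p.2)).
have dc (j : 'I_k) : continuous (fun p : T => node_dist j (val p.2)).
  move=> p; apply: (@continuous_comp _ _ _ (fun p : T => val p.2) (node_dist j)).
    apply: (@continuous_comp _ _ _ snd (val : unit_interval R -> R)).
      exact: cvg_snd.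
    exact: val_unit_continuous.
  exact: node_dist_continuous.
apply: (@joint_path_section R k M _ (fun x t => f (near_node t) (x, t))).
- exact: open_box.
- move=> x t bx.
  apply: (@finite_pasting _ _ _
    (fun j => [set p : T | node_dist j (val p.2) <= 1]) f) => //.
  + move=> j; apply: (@closed_comp _ _ (fun p : T => node_dist j (val p.2))
      [set t | t <= 1]).
      by move=> p _; exact: dc.
    exact: closed_le.
  + case=> y u; exists (near_node u) => //=; exact: nodeP.
  move=> j /= jt; have [_ K1 Kc] := KP (a j) (x j) (bx j); split.
    apply: (@continuous_comp _ _ _
      (fun p : T => (p.1 j, node_dist j (val p.2))) (fun p => K (a j) p.1 p.2)).
      apply: continuous_at_pair; last exact: dc.
      apply: (@continuous_comp _ _ _ fst (fun x : {ptws 'I_k -> M} => x j)).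
        exact: cvg_fst.
      exact: ptws_proj_continuous.
    exact: Kc.
  have [->//|ne] := eqVneq j (near_node t).
  have [d1 d2] := node_dist_uniq jt (nodeP t) ne.
  by rewrite /f /= d1 d2 K1; have [_ -> _] := KP _ _ (bx (near_node t)).
- move=> x i bx.
  have [K0 _ _] := KP (a i) (x i) (bx i).
  have di : node_dist i (val (unit_node R i)) = 0.
    by rewrite node_dist_node// subrr normr0 mulr0.
  have [->|ne] := eqVneq (near_node (unit_node R i)) i; first by rewrite /f /= di.
  have [|_] := node_dist_uniq (nodeP (unit_node R i)) _ ne; rewrite di ?ler01//.
  by move=> /eqP; rewrite eq_sym oner_eq0.
Qed.

(** The largest flip-invariant subset of O. *)
Definition flip_core (k : nat) (M : topologicalType) (tau : M -> M)
    (O : set {ptws 'I_k -> M}) : set {ptws 'I_k -> M} :=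
  [set x : {ptws 'I_k -> M} |
    forall y, (forall j, y j = x j \/ y j = tau (x j)) -> O y].

(** The core is the intersection of the 2^k translates of O under the flips,
    hence open. *)
Lemma flip_coreP (k : nat) (M : topologicalType) (tau : M -> M)
    (O : set {ptws 'I_k -> M}) :
  continuous tau -> involutive tau -> open O ->
  [/\ open (flip_core tau O), flip_invariant tau (flip_core tau O) &
      flip_core tau O `<=` O].
Proof.
move=> tau_cont tau_inv oO; split; last first.
- by move=> x; apply=> j; left.
- move=> x y xy Cx z yz; apply: Cx => j.
  have [->|->] := yz j; have [->|->] := xy j; rewrite ?tau_inv; by [left|right].
pose flip (e : {ffun 'I_k -> bool}) (x : {ptws 'I_k -> M}) : {ptws 'I_k -> M} :=
  fun j => if e j then tau (x j) else x j.
rewrite (_ : flip_core _ _ = [set x | forall e, O (flip e x)]).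
  apply: open_forall => e; apply: open_comp => // x _.
  apply: continuous_at_ptws => j; rewrite /flip.
  case: (e j); last exact: ptws_proj_continuous.
  apply: (@continuous_comp _ _ _ (fun x : {ptws 'I_k -> M} => x j) tau).
    exact: ptws_proj_continuous.
  exact: tau_cont.
apply/seteqP; split=> x /= Cx.
  by move=> e; apply: Cx => j; rewrite /flip; case: (e j); [right|left].
move=> y xy; have := Cx [ffun j => `[< y j <> x j >]]; congr O.
apply/funext => j; rewrite /flip ffunE; case: asboolP => [|/contrapT//].
by case: (xy j).
Qed.

(** The colour classes are themselves flip-invariant, because the first index
    b is; hence they survive the passage to the invariant cores. *)
Lemma TC_sharp_star_cover (R : realType) (k : nat) (hk : (2 <= k)%N)
    (M : topologicalType) (tau : M -> M) (tau_cont : continuous tau)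
    (tau_inv : involutive tau) (n : nat) (U : 'I_n.+1 -> set M) :
  path_connected_space R M -> completely_normal_space {ptws 'I_k -> M} ->
  (forall i, [/\ open (U i), forall x, U i x -> U i (tau x) &
                 null_homotopic_inclusion R (U i)]) ->
  \bigcup_i U i = setT ->
  exists V : 'I_(k * n).+1 -> set {ptws 'I_k -> M},
    (forall s, [/\ open (V s), flip_invariant tau (V s) & path_section R (V s)]) /\
    \bigcup_s V s = setT.
Proof.
move=> pcM cnM UP Uc.
have oU i : open (U i) by have [] := UP i.
have invU i x : U i x -> U i (tau x) by have [_ + _] := UP i; apply.
have [b [Ub bmin]] := first_index Uc.
have b_tau x : b (tau x) = b x.
  apply/val_inj/eqP; rewrite eqn_leq /= bmin ?bmin//; last exact: invU.
  by have := invU _ _ (Ub (tau x)); rewrite tau_inv.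
pose I := {ffun 'I_k -> 'I_n.+1}.
pose c (x : {ptws 'I_k -> M}) : I := [ffun j => b (x j)].
pose r (a : I) : nat := (\sum_j a j)%N.
have [||||O [oO cO OG dO]] := @ranked_open_family _ I 'I_k c
    (fun j a => a j : nat) r (fun a => box U a) cnM.
- move=> j v; rewrite (_ : mkset _ = [set x : {ptws 'I_k -> M} | (b (x j) <= v)%N]).
    apply: (@open_comp _ _ (fun p : {ptws 'I_k -> M} => p j)
      [set x | (b x <= v)%N]); last exact: first_index_open.
    by move=> p _; exact: ptws_proj_continuous.
  by apply/seteqP; split=> x /=; rewrite ffunE.
- move=> a a' ne rE; have [j nej] : exists j, (a j : nat) != a' j.
    apply: contrapT => nex; apply: ne; apply/ffunP => j; apply/eqP/negPn/negP.
    by move=> nj; apply: nex; exists j.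
  exact: eq_sum_ltn rE nej.
- by move=> a; exact: open_box.
- by move=> x j; rewrite ffunE.
pose C (a : I) := flip_core tau (O a).
have CP a : [/\ open (C a), flip_invariant tau (C a) & C a `<=` O a].
  exact: flip_coreP.
have oC a : open (C a) by have [] := CP a.
have CO a : C a `<=` O a by have [] := CP a.
exists (fun s => \bigcup_(a in [set a | r a = s]) C a); split.
  move=> s; split; first by apply: bigcup_open => a _.
    move=> x y xy [a ra Ca]; exists a => //.
    by have [_ inv _] := CP a; exact: inv Ca.
  apply: path_section_disjoint => //; first exact: ltnW.
    move=> a; have [|s' [sc sE]] := path_section_box (U := U) a hk pcM oU.
      by move=> i; have [] := UP i.
    have CG : C a `<=` box U a by move=> x /CO /OG.
    exists s'; split; last by move=> x /CG; exact: sE.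
    exact: continuous_subspaceW sc.
  move=> a a' /= ra ra' ne; rewrite -subset0 => x [/CO Ox /CO Ox'].
  by rewrite -(dO a a' ne) // ra ra'.
rewrite -subTset => x _.
have rlt : (r (c x) < (k * n).+1)%N.
  rewrite ltnS /r; apply: leq_trans (_ : \sum_(j < k) n <= _)%N.
    by apply: leq_sum => j _; exact: leq_ord.
  by rewrite sum_nat_const card_ord.
exists (Ordinal rlt) => //; exists (c x) => // y xy.
have -> : c x = c y.
  by apply/ffunP => j; rewrite !ffunE; have [->|->] := xy j.
exact: cO.
Qed.

(** The infimum of a nonempty set of natural numbers is attained. *)
Lemma cover_numberP (R : realType) (T : topologicalType) (P : set T -> Prop) :
  cover_number R P = +oo%E \/
  exists n, cover_number R P = n%:R%:E /\
    exists U : 'I_n -> set T, (forall i, open (U i) /\ P (U i)) /\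
      \bigcup_i U i = setT.
Proof.
pose S := [set n : nat | exists U : 'I_n -> set T,
  (forall i, open (U i) /\ P (U i)) /\ \bigcup_i U i = setT].
have [exS|nS] := pselect (exists n, `[< S n >]).
  right; have [n /asboolP Sn nmin] := ex_minnP exS.
  exists n; split=> //; apply/le_anti/andP; split.
    by apply: ereal_inf_lbound; exists n.
  apply: le_ereal_inf_tmp => _ [m Sm <-]; rewrite lee_fin ler_nat.
  by apply: nmin; exact/asboolP.
left; rewrite /cover_number (_ : [set _ | _ in _] = set0) ?ereal_inf0//.
by rewrite -subset0 => y [m Sm _]; apply: nS; exists m; exact/asboolP.
Qed.

Lemma cover_number_le (R : realType) (T : topologicalType) (P : set T -> Prop)
    (n : nat) (U : 'I_n -> set T) :
  (forall i, open (U i) /\ P (U i)) -> \bigcup_i U i = setT ->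
  (cover_number R P <= n%:R%:E)%E.
Proof. by move=> UP Uc; apply: ereal_inf_lbound; exists n => //; exists U. Qed.

Theorem proposition6p4 (R : realType) (k : nat) (hk : (2 <= k)%N)
    (M : topologicalType) (hM : path_connected_space R M)
    (tau : M -> M) (tau_cont : continuous tau) (tau_inv : involutive tau)
    (hX : hausdorff_space (proj_prod tau (@antipode R)))
    (hXk : completely_normal_space
             {ptws 'I_k -> proj_prod tau (@antipode R)}) :
  (TC R k (proj_prod tau (@antipode R))
     <= k%:R%:E + TC_sharp_star R k (generated_group tau))%E /\
  (k%:R%:E + TC_sharp_star R k (generated_group tau)
     <= k%:R%:E * cat_sharp R (generated_group tau) + 1%:E)%E.
Proof.
split.
  rewrite /TC_sharp_star.
  have [->|[n [-> [U [UP Uc]]]]] := @cover_numberP R _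
    (fun U : set {ptws 'I_k -> M} =>
       invariant_set (power_group k (generated_group tau)) U /\ path_section R U).
    by rewrite leey.
  have [|V [VP Vc]] := @TC_cover R k hk M tau tau_cont tau_inv n U hXk _ Uc.
    move=> i; have [oU [inv sec]] := UP i; split=> //.
    exact/invariant_power_groupE.
  by rewrite -EFinD -natrD; exact: cover_number_le Vc.
rewrite /cat_sharp.
have [->|[n [-> [U [UP Uc]]]]] := @cover_numberP R _
  (fun U : set M =>
     invariant_set (generated_group tau) U /\ null_homotopic_inclusion R U).
  by rewrite gt0_muley ?lte_fin ?ltr0n ?leey//; case: (k) hk.
have [[m _] _] := hM.
(* M is nonempty, so a cover has at least one member; with n + 1 members the
   bound to prove is k + (k n + 1) <= k (n + 1) + 1. *)
case: n U UP Uc => [|n] U UP Uc.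
  by have [[]] : (\bigcup_i U i) m by rewrite Uc.
have [|V [VP Vc]] := @TC_sharp_star_cover R k hk M tau tau_cont tau_inv n U hM
    (completely_normal_fiber tau_cont tau_inv hXk) _ Uc.
  move=> i; have [oU [inv nU]] := UP i; split=> // x.
  by apply: inv; exact: generated_group_gen.
have le : (TC_sharp_star R k (generated_group tau) <= (k * n).+1%:R%:E)%E.
  apply: cover_number_le Vc => i; have [oV inv sec] := VP i; split=> //.
  by split=> //; exact/invariant_power_groupE.
apply: (le_trans (leeD2l _ le)).
rewrite -EFinD -EFinM -EFinD lee_fin -natrD -natrM -[1%R]/(1%:R) -natrD.
by rewrite ler_nat; lia.
Qed.
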